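(* Let $G$ be a graph of order $n$ with maximum degree $\Delta(G)=2$. Then $$\operatorname{th}_+(G)\ \ge\ \left\lceil \sqrt{2n}-\tfrac12\right\rceil .$$
   Context: All graphs are finite, simple and undirected. The order of $G$ is $|V(G)|$ and $\Delta(G)$ is its maximum vertex degree. Positive semidefinite (PSD) color change rule: each vertex of $G$ is blue or white; let $B$ be the current set of blue vertices and let $W_1,\dots,W_k$ be the vertex sets of the connected components of $G-B$. A white vertex $w\in W_i$ is colored blue (is forced by the blue vertex $v$) when $w$ is the only white neighbor of $v$ in the induced subgraph $G[W_i\cup B]$. Starting with exactly the vertices of $S\subseteq V(G)$ blue, at each time step all possible forces are performed simultaneously. $S$ is a PSD zero forcing set if eventually all vertices become blue; in that case $\operatorname{pt}_+(G;S)$ is the number of time steps needed to color all vertices blue (so it is $0$ if $S=V(G)$), and otherwise $\operatorname{pt}_+(G;S)=\infty$. Define $\operatorname{th}_+(G;S)=|S|+\operatorname{pt}_+(G;S)$, and the PSD throttling number $\operatorname{th}_+(G)=\min\{\operatorname{th}_+(G;S): S \text{ is a PSD zero forcing set of } G\}$. *)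

(* Defs.v *)
From mathcomp Require Import all_boot.

Set Implicit Arguments.
Unset Strict Implicit.
Unset Printing Implicit Defensive.

(* A simple graph is a symmetric irreflexive relation [e] on a finType [T];
   these two properties are hypotheses of the theorems, not of the
   definitions. *)
Section PSDForcing.

Variables (T : finType) (e : rel T).
Implicit Types (B S U W : {set T}) (v w : T).

Definition neighbors v : {set T} := [set w | e v w].

Definition max_degree : nat := \max_(v : T) #|neighbors v|.

Definition induced U : rel T := [rel x y | [&& x \in U, y \in U & e x y]].

Definition components U : {set {set T}} :=
  equivalence_partition (connect (induced U)) U.

Definition psd_force B v w : bool :=
  (v \in B) &&
  [exists W in components (~: B),
     (w \in W) && ([set x in ~: B | induced (W :|: B) v x] == [set w])].

Definition psd_step B : {set T} :=
  B :|: [set w | [exists v, psd_force B v w]].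

Definition psd_zfs S : Prop := exists t, iter t psd_step S == [set: T].

Lemma psd_iter_stable S t :
  psd_step (iter t psd_step S) = iter t psd_step S \/
  t <= #|iter t psd_step S|.
Proof.
elim: t => [|t [IH|IH]]; [by right | by left; rewrite /= IH |].
have [eqS|neS] := eqVneq (psd_step (iter t psd_step S)) (iter t psd_step S).
  by left; rewrite /= eqS.
right; apply: leq_ltn_trans IH _; apply: proper_card.
by rewrite properEneq eq_sym neS subsetUl.
Qed.

Lemma psd_iter_card S t :
  iter t psd_step S == [set: T] -> iter #|T| psd_step S == [set: T].
Proof.
case: (psd_iter_stable S #|T|) => [fixS|cardS] St; last first.
  by rewrite eqEcard subsetT cardsT.
have sub m k : iter m psd_step S \subset iter (k + m) psd_step S.
  by elim: k => // k IH; apply: subset_trans IH _; apply: subsetUl.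
have fixk k : iter (k + #|T|) psd_step S = iter #|T| psd_step S.
  by elim: k => //= k ->.
by rewrite -(fixk t) eqEsubset subsetT addnC -(eqP St) sub.
Qed.

Lemma psd_zfs_dec S : decidable (psd_zfs S).
Proof.
have [St|nSt] := boolP (iter #|T| psd_step S == [set: T]).
  by left; exists #|T|.
by right=> -[t /psd_iter_card St]; rewrite St in nSt.
Qed.

(* [None] stands for infinity. *)
Definition psd_pt S : option nat :=
  if psd_zfs_dec S is left forcing then Some (ex_minn forcing) else None.

Definition psd_th_set S : option nat := omap (addn #|S|) (psd_pt S).

Lemma psd_th_set_ex : exists k, [exists S, psd_th_set S == Some k].
Proof.
have zT : psd_zfs [set: T] by exists 0.
rewrite /psd_th_set /psd_pt; case E: (psd_zfs_dec [set: T]) => [h|//].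
by exists (#|[set: T]| + ex_minn h); apply/existsP; exists [set: T]; rewrite E.
Qed.

Definition psd_th : nat := ex_minn psd_th_set_ex.

End PSDForcing.

(* Main.v *)
Require Import Defs.
From mathcomp Require Import all_boot all_order all_algebra reals.
From mathcomp Require Import lra.
Import Order.TTheory GRing.Theory Num.Theory.
Local Open Scope ring_scope.

(** A force always goes along an edge, so after [t] steps the blue vertices
    all lie within distance [t] of the initial set [S]; in a graph of maximum
    degree 2 a ball of radius [t] around one vertex has at most [2 * t + 1]
    elements.  A forcing set of size [s] with propagation time [t] therefore
    gives [n <= s * (2 * t + 1)], and the inequality of arithmetic and geometric
    means, applied to [2 * s] and [2 * t + 1], turns this into
    [2 * n <= (s + t + 1 / 2) ^+ 2].  Taking square roots bounds [s + t].

    The linear growth [#|B_t| <= s * (2 * t + 1)] is proved without speaking of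
    distances, through the number of edges that leave the blue set.  That number
    is at most [2 * s] at the start; it bounds the number of vertices that one
    step can add ([card_growth]); and it never increases, because a new vertex
    uses up an edge towards the old blue set and, having degree at most 2, has
    at most one other edge ([boundary_growth]). *)

Section EdgeCounts.

Variables (T : finType) (e : rel T).
Hypothesis e_sym : symmetric e.
Implicit Types (A B C D : {set T}) (v w : T).

(** Ordered pairs are counted: an edge inside [A :&: C] counts twice. *)
Definition edges_between A C : nat := (\sum_(v in A) #|neighbors e v :&: C|)%N.

Lemma edges_betweenE A C :
  edges_between A C = (\sum_(v in A) \sum_(w in C) e v w)%N.
Proof.
apply: eq_bigr => v _; rewrite -sum1_card [RHS]big_mkcond [LHS]big_mkcond /=.
by apply: eq_bigr => w _; rewrite !inE andbC; case: (w \in C); case: (e v w).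
Qed.

Lemma edges_betweenC A C : edges_between A C = edges_between C A.
Proof.
rewrite !edges_betweenE exchange_big /=.
by apply: eq_bigr => v _; apply: eq_bigr => w _; rewrite e_sym.
Qed.

Lemma edges_between_splitl {A B} C : A \subset B ->
  edges_between B C = (edges_between A C + edges_between (B :\: A) C)%N.
Proof. by move=> sAB; rewrite /edges_between (big_setID A) (setIidPr sAB). Qed.

Lemma edges_between_splitr A {C D} : C \subset D ->
  edges_between A D = (edges_between A C + edges_between A (D :\: C))%N.
Proof.
by move=> sCD; rewrite !(edges_betweenC A) (edges_between_splitl _ sCD).
Qed.

Definition boundary B : nat := edges_between B (~: B).

Definition grows_along_edges B B' : Prop :=
  B \subset B' /\ {in B' :\: B, forall w, exists2 v, v \in B & e v w}.

Lemma leq_card_edges_between {A B} :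
    {in A, forall w, exists2 v, v \in B & e v w} ->
  (#|A| <= edges_between A B)%N.
Proof.
move=> adj; rewrite -sum1_card; apply: leq_sum => w /adj[v vB evw].
by apply/card_gt0P; exists v; rewrite !inE e_sym evw.
Qed.

Lemma card_growth {B B'} : grows_along_edges B B' ->
  (#|B'| <= #|B| + boundary B)%N.
Proof.
case=> sBB' adj; rewrite -(cardsID B B') (setIidPr sBB') leq_add2l.
apply: leq_trans (leq_card_edges_between adj) _.
have sDC : B' :\: B \subset ~: B by rewrite setDE subsetIr.
by rewrite edges_betweenC /boundary (edges_between_splitr B sDC) leq_addr.
Qed.

Lemma boundary_le_degree d B :
  (max_degree e <= d)%N -> (boundary B <= #|B| * d)%N.
Proof.
move=> degd; rewrite -sum_nat_const; apply: leq_sum => v _.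
apply: leq_trans (subset_leq_card (subsetIl _ _)) _.
exact: leq_trans (leq_bigmax v) degd.
Qed.

(** The edges leaving [B] go to [~: B'] or to the new vertices [B' :\: B].
    The former still leave [B'].  There are at least as many of the latter as
    there are new vertices, while each new vertex has at most one edge
    leaving [B']. *)
Lemma boundary_growth {B B'} : (max_degree e <= 2)%N ->
  grows_along_edges B B' -> (boundary B' <= boundary B)%N.
Proof.
move=> deg2 [sBB' adj].
have sCC : ~: B' \subset ~: B by rewrite setCS.
rewrite /boundary (edges_between_splitl _ sBB') (edges_between_splitr B sCC).
have -> : ~: B :\: ~: B' = B' :\: B by rewrite !setDE setCK setIC.
rewrite leq_add2l [leqRHS]edges_betweenC.
apply: leq_trans (leq_card_edges_between adj).
rewrite -sum1_card; apply: leq_sum => w wD.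
have [v vB evw] := adj w wD.
have vN : v \in neighbors e w by rewrite inE e_sym.
have Nw2 : (#|neighbors e w| <= 2)%N by apply: leq_trans (leq_bigmax w) deg2.
have sN : neighbors e w :&: ~: B' \subset neighbors e w :\ v.
  apply/subsetP => x; rewrite !inE => /andP[-> xB']; rewrite andbT.
  by apply: contraNneq xB' => ->; apply: (subsetP sBB').
apply: leq_trans (subset_leq_card sN) _.
by move: Nw2; rewrite (cardsD1 v) vN.
Qed.

Lemma psd_step_grows B : grows_along_edges B (psd_step e B).
Proof.
split=> [|w]; first exact: subsetUl.
rewrite !inE => /andP[/negPf-> /= /existsP[v /andP[vB]]].
case/existsP=> W /and3P[_ _ /eqP/setP/(_ w)].
by rewrite !inE eqxx => /and4P[_ _ _ evw]; exists v.
Qed.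

Lemma card_iter_psd_step S t : (max_degree e <= 2)%N ->
  (#|iter t (psd_step e) S| <= #|S| * (2 * t).+1)%N.
Proof.
move=> deg2; set B := fun i => iter i (psd_step e) S.
have bnd i : (boundary (B i) <= #|S| * 2)%N.
  elim: i => [|i IH]; first exact: boundary_le_degree.
  exact: leq_trans (boundary_growth deg2 (psd_step_grows _)) IH.
rewrite -/(B t); elim: t => [|t IH]; first by rewrite muln1.
apply: leq_trans (card_growth (psd_step_grows (B t))) _.
by rewrite (mulnSr 2%N) -addSn mulnDr leq_add.
Qed.

End EdgeCounts.

Lemma psd_thP (T : finType) (e : rel T) : exists (S : {set T}) (t : nat),
  psd_th e = (#|S| + t)%N /\ iter t (psd_step e) S = [set: T].
Proof.
rewrite /psd_th; case: ex_minnP => k /existsP[S +] _.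
rewrite /psd_th_set /psd_pt; case: (psd_zfs_dec e S) => //= forcing.
by case: ex_minnP => t /eqP St _ /eqP[<-]; exists S, t.
Qed.

Theorem proposition2p5 (R : realType) (T : finType) (e : rel T) (n : nat)
    (e_sym : symmetric e) (e_irr : irreflexive e)
    (order_n : #|T| = n) (Delta2 : max_degree e = 2%N) :
  (psd_th e)%:Z >= Num.ceil (Num.sqrt (2 * n%:R) - 1 / 2 : R).
Proof.
have [S [t [-> St]]] := psd_thP T e.
have deg2 : (max_degree e <= 2)%N by rewrite Delta2.
have := card_iter_psd_step T e e_sym S t deg2.
rewrite St cardsT order_n -(ler_nat R) natrM -natr1 natrM => le_n.
rewrite Num.Theory.ceil_le_int lerBlDr -pmulrn natrD.
have s_ge0 : 0 <= #|S|%:R :> R by [].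
have t_ge0 : 0 <= t%:R :> R by [].
rewrite -[leRHS]ger0_norm ?addr_ge0 ?divr_ge0 // -sqrtr_sqr ler_wsqrtr //.
(* this square is the gap in the mean inequality *)
have := sqr_ge0 (#|S|%:R - t%:R - 1 / 2 : R).
nra.
Qed.
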